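(* Let $L$ be a finite distributive lattice and $x\in L$. If $x$ is covered by at least three elements of $L$ and $x$ covers at least three meet-irreducible elements of $L$, then $L$ is non-matchable.
   Context: An element of a finite lattice is meet-irreducible if it is covered by exactly one element. Let $G$ be a finite plane bipartite graph with a perfect matching, vertices properly colored black and white. A cell is an inner face whose boundary is a cycle. For a perfect matching $M$, an $M$-alternating cycle is proper if, traversing it clockwise, every edge in $M$ goes from its white end to its black end. The $Z$-transformation digraph $\vec{Z}(G)$ has vertex set $\mathcal{M}(G)$ (the perfect matchings of $G$) and an arc $M_1\to M_2$ iff $M_1\oplus M_2$ is the edge set of a cell that is a proper $M_1$-alternating cycle; $M_1\le M_2$ iff there is a directed path from $M_2$ to $M_1$. $G$ is elementary if connected and every edge lies in a perfect matching; $G$ is weakly elementary if for every cycle $C$ with $G-V(C)$ having a perfect matching, $C$ together with its interior forms an elementary subgraph. For plane weakly elementary bipartite $G$, $(\mathcal{M}(G),\le)$ is a finite distributive lattice. A finite distributive lattice $L$ is matchable if $L\cong\mathcal{M}(G)$ for some plane weakly elementary bipartite graph $G$; otherwise it is non-matchable. *)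

(* Defs.v *)
From mathcomp Require Import all_boot all_order.
From Stdlib Require Import Relations.Relation_Operators.
Set Implicit Arguments. Unset Strict Implicit. Unset Printing Implicit Defensive.

(* A finite simple plane graph, possibly disconnected, given combinatorially.
   - [rot v u] is the neighbour of [v] following [u] counterclockwise around [v];
     [rot v] permutes the neighbours of [v] cyclically.
   - [side u v] is the face to the right of the edge [uv] traversed from [u] to [v].
     Walking along a face kept on the right, one goes on from [uv] to the edge
     from [v] to [rot v u].
   - A face of a disconnected plane graph may have several boundary walks, so
     faces are not merely the orbits of the map (u, v) |-> (v, rot v u): they form
     a type of their own, and [side] records which boundary walks belong to the
     same face, hence which components are nested in which faces.
   - The last two fields say that the surface is the sphere: it is connected,
     and Euler's formula V - E + F = 1 + (number of components) holds.  For a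
     connected graph this is planarity of the rotation system; in general each
     component has genus 0 and the incidence structure between components and
     faces is a tree.
   - The distinguished face [outer] is the unbounded one.
   By [pg_connected] there is no isolated vertex; this excludes no graph that has
   a perfect matching. *)
Record plane_graph := PlaneGraph {
  vertex : finType;
  adj : rel vertex;
  adj_sym : symmetric adj;
  adj_irr : irreflexive adj;
  rot : vertex -> vertex -> vertex;
  rot_adj : forall v u, adj v u -> adj v (rot v u);
  rot_cyclic : forall v u w, adj v u -> adj v w -> fconnect (rot v) u w;
  face : finType;
  outer : face;
  side : vertex -> vertex -> face;
  side_rot : forall u v, adj u v -> side v (rot v u) = side u v;
  pg_connected : forall x y : vertex + face,
    connect (fun a b => match a, b with
             | inl u, inl v => adj u v
             | inl u, inr f | inr f, inl u =>
                 [exists v, adj u v && (side u v == f)]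
             | inr _, inr _ => false
             end) x y;
  pg_euler : #|vertex| + #|face|
    = #|[set [set p.1; p.2] | p : vertex * vertex & adj p.1 p.2]|
      + n_comp adj (@predT vertex) + 1
}.

Section Graph.
Variable G : plane_graph.
Local Notation V := (vertex G).
Implicit Types (u v : V) (W : {set V}) (H M C : {set {set V}}) (f g : face G).

Definition edges : {set {set V}} :=
  [set [set p.1; p.2] | p : V * V & adj p.1 p.2].

(* A subgraph is given by its vertex set [W] and its edge set [H]. *)
Definition perfect_matching W H M : bool := (M \subset H) && partition M W.

Definition connected W H : Prop :=
  forall u v, u \in W -> v \in W ->
    connect (fun a b => [set a; b] \in H) u v.

Definition elementary W H : Prop :=
  connected W H /\
  forall e, e \in H -> exists2 M, perfect_matching W H M & e \in M.

(* Cycles are represented by their edge sets, so that the vertex set of the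
   cycle [C] is [cover C]. *)
Definition is_cycle C : Prop :=
  exists s : seq V, [/\ 2 < size s, ucycle (@adj G) s
    & C = [set [set x; next s x] | x in s]].

(* The faces inside [C] are those that cannot be reached from the outer face by
   crossing edges not in [C]. *)
Definition inside C f : bool :=
  ~~ connect (fun f1 f2 => [exists u, exists v,
        [&& adj u v, [set u; v] \notin C, side u v == f1 & side v u == f2]])
      (outer G) f.

(* The edges of the subgraph formed by [C] together with its interior. *)
Definition disc C : {set {set V}} :=
  [set [set p.1; p.2] | p : V * V &
     adj p.1 p.2 && (([set p.1; p.2] \in C)
       || inside C (side p.1 p.2) && inside C (side p.2 p.1))].

Definition weakly_elementary : Prop :=
  forall C, is_cycle C ->
    (exists M, perfect_matching (~: cover C)
                 [set e in edges | e \subset ~: cover C] M) ->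
    elementary (cover (disc C)) (disc C).

Definition boundary f : {set {set V}} :=
  [set [set p.1; p.2] | p : V * V & adj p.1 p.2 && (side p.1 p.2 == f)].

Definition cell f : Prop := f <> outer G /\ is_cycle (boundary f).

(* [c v] is true when [v] is white and false when [v] is black. *)
Definition proper_coloring (c : V -> bool) : Prop :=
  forall u v, adj u v -> c u != c v.

Definition alternating M C : Prop :=
  is_cycle C /\
  forall e1 e2, e1 \in C -> e2 \in C -> e1 != e2 -> ~~ [disjoint e1 & e2] ->
    (e1 \in M) != (e2 \in M).

(* Traversing [C] clockwise means keeping its interior on the right. *)
Definition proper_alternating (c : V -> bool) M C : Prop :=
  alternating M C /\
  forall u v, adj u v -> [set u; v] \in C -> inside C (side u v) ->
    [set u; v] \in M -> c u /\ ~~ c v.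

Definition matching : Type := {M : {set {set V}} | perfect_matching setT edges M}.

Definition symdiff (M1 M2 : {set {set V}}) : {set {set V}} :=
  (M1 :\: M2) :|: (M2 :\: M1).

Definition Zarc (c : V -> bool) (M1 M2 : matching) : Prop :=
  exists f, [/\ cell f, symdiff (val M1) (val M2) = boundary f
    & proper_alternating c (val M1) (boundary f)].

Definition Zle (c : V -> bool) (M1 M2 : matching) : Prop :=
  clos_refl_trans matching (Zarc c) M2 M1.

End Graph.

Section Lattice.
Variables (disp : Order.disp_t) (L : finDistrLatticeType disp).
Implicit Types x y z : L.

Definition covered_by x y : bool :=
  (x < y)%O && [forall z, ~~ ((x < z)%O && (z < y)%O)].

Definition meet_irreducible x : bool := #|[set y | covered_by x y]| == 1.

(* An isomorphism of lattices is the same thing as an isomorphism of their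
   orders. *)
Definition matchable : Prop :=
  exists (G : plane_graph) (c : vertex G -> bool),
    [/\ proper_coloring c, inhabited (matching G), weakly_elementary G
      & exists phi : L -> matching G,
          bijective phi /\ forall x y, (x <= y)%O <-> Zle c (phi x) (phi y)].

End Lattice.

(* Main.v *)
From mathcomp Require Import all_boot all_order zify.
From Stdlib Require Import Relations.Relation_Operators Relations.Operators_Properties.
Require Import Defs.
Import Order.POrderTheory.
Set Implicit Arguments. Unset Strict Implicit. Unset Printing Implicit Defensive.

(** Let [M] be the perfect matching corresponding to [x].  Each element covering
    [x] gives a cell flipped into [M], each meet-irreducible element [y] covered by
    [x] gives a cell flipped out of [M].  Two such cells [f] and [g] share a vertex:
    otherwise [f] could still be flipped in the matching of [y], so that [y] would
    have an upper bound which is not above [x], because the number of times a path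
    of flips uses each cell depends only on its ends.  At a common vertex the two
    boundaries have the same [M]-edge, so the dual graph contains K_{3,3}.

    That is impossible: a simple bipartite subgraph of the dual with edge set [K]
    and [n] non-isolated faces satisfies [|K| + 4 <= 2 n] as soon as [|K| > 1].  For
    a set [S] of edges, let [c(S)] be the number of components of [(V, S)] and
    [d(S)] that of the dual graph with edge set [S].  An edge joining two
    components of [S] closes no cycle, so adding it to [S] leaves [d(E \ S)]
    unchanged; hence [|V| + d(E \ S) <= |S| + c(S) + 1].  With Euler's formula this
    gives [c(E \ K) >= c(E) + |K| - n + 1].  The edges of [K] leaving a component of
    [E \ K] form a bipartite graph without vertices of degree one, so there are
    none or at least four of them.  At most [|K| / 2] components are of the second
    kind, and [c(E \ K) - c(E)] is less than their number unless it is zero. *)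

(** * Finite sets and sequences *)

Lemma eq_set2 (T : finType) (a b u v : T) :
  [set a; b] = [set u; v] -> (a, b) = (u, v) \/ (a, b) = (v, u).
Proof.
move=> ab_uv; have /set2P a_uv : a \in [set u; v] by rewrite -ab_uv set21.
have /set2P b_uv : b \in [set u; v] by rewrite -ab_uv set22.
have /set2P u_ab : u \in [set a; b] by rewrite ab_uv set21.
have /set2P v_ab : v \in [set a; b] by rewrite ab_uv set22.
case: a_uv b_uv u_ab v_ab => -> [] ->; [|by left|by right|].
  by move=> _ [] ->; left.
by case=> ->; left.
Qed.

Lemma next_neq_prev (T : eqType) (s : seq T) x :
  uniq s -> 2 < size s -> x \in s -> next s x != prev s x.
Proof.
move=> s_uniq s_gt2 xs; apply: contraTneq isT => next_prev_x.
have : next s (next s x) = x by rewrite next_prev_x next_prev.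
have [i s' rot_s] := rot_to xs; rewrite -!(next_rot i s_uniq).
move: s_uniq s_gt2; rewrite -(rot_uniq i) -(size_rot i) rot_s.
case: s' {rot_s} => [|y [|z s']] //=; rewrite !inE !negb_or.
move=> /andP[/and3P[xy xz _] _] _.
by rewrite eqxx eq_sym (negPf xy) eqxx => zx; rewrite zx eqxx in xz.
Qed.

Lemma ex_transversal (T U : finType) (A : {set T}) (R : T -> U -> Prop) :
    {in A, forall x, exists y, R x y} ->
    (forall x x' y, R x y -> R x' y -> x = x') ->
  exists B : {set U}, [/\ #|B| = #|A|,
    {in B, forall y, exists2 x, x \in A & R x y} &
    forall x, {in B &, forall y y', R x y -> R x y' -> y = y'}].
Proof.
move=> R_total R_inj.
have /fin_all_exists[h hR] (p : {x | x \in A}) : exists y, R (val p) y.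
  exact/R_total/valP.
have h_val p x : R x (h p) -> x = val p by move/R_inj; apply.
exists (h @: setT); split.
- rewrite card_imset ?cardsT ?card_sig // => p p' hpp'.
  by apply/val_inj/h_val; rewrite -hpp'.
- by move=> _ /imsetP[p _ ->]; exists (val p); rewrite ?(valP p).
move=> x _ _ /imsetP[p _ ->] /imsetP[p' _ ->] /h_val xp /h_val xp'.
by congr h; apply: val_inj; rewrite -xp.
Qed.

Lemma card_stable_preim (T : finType) (A : {set T}) (h : T -> T) (P : pred T) :
  {in A &, injective h} -> {in A, forall x, h x \in A} ->
  #|[set x in A | P (h x)]| = #|[set x in A | P x]|.
Proof.
move=> h_inj hA; have hAE : h @: A = A.
  apply/eqP; rewrite eqEcard card_in_imset // leqnn andbT.
  by apply/subsetP => _ /imsetP[x xA ->]; apply: hA.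
have <- : h @: [set x in A | P (h x)] = [set x in A | P x].
  apply/setP => y; apply/imsetP/idP => [[x]|]; rewrite !inE.
    by case/andP=> /hA hxA Phx ->; rewrite hxA.
  case/andP=> yA Py; move: (yA); rewrite -{1}hAE => /imsetP[x xA yE].
  by exists x; rewrite // inE xA -yE.
rewrite card_in_imset // => x y; rewrite !inE => /andP[xA _] /andP[yA _].
exact: h_inj.
Qed.

(* [E] is the edge set of a simple bipartite graph in which [e] joins [p e] to
   [q e]. *)
Lemma simple_bipartite_card_ge4 (T : finType) (A B : eqType) (E : {set T})
    (p : T -> A) (q : T -> B) :
    {in E &, injective (fun e => (p e, q e))} ->
    {in E, forall e, exists2 e', e' \in E :\ e & p e' = p e} ->
    {in E, forall e, exists2 e', e' \in E :\ e & q e' = q e} ->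
  E != set0 -> 4 <= #|E|.
Proof.
move=> pq_inj p_deg q_deg /set0Pn[e eE].
have [e' /setD1P[e'_e e'E] p_e'] := p_deg e eE.
have [f /setD1P[f_e fE] q_f] := q_deg e eE.
have [f' /setD1P[f'_f f'E] p_f'] := p_deg f fE.
have p_f : p f != p e.
  by apply: contra_neq f_e => p_f; apply: pq_inj; rewrite // p_f q_f.
have p_neq a b : p a = p e -> p b = p f -> a != b.
  by move=> pa pb; apply: contraNneq p_f => ab; rewrite -pb -ab pa.
have path_uniq : uniq [:: e'; e; f; f'].
  by rewrite /= !inE !negb_or e'_e (eq_sym f) f'_f !p_neq.
have path_sub : {subset [:: e'; e; f; f'] <= enum E}.
  by apply/allP; rewrite /= !mem_enum eE e'E fE f'E.
by have := uniq_leq_size path_uniq path_sub; rewrite -cardE.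
Qed.

(** * Connected components *)

Section Components.
Variable T : finType.
Implicit Types e : rel T.

Lemma connect_invariant (rT : Type) e (h : T -> rT) :
  (forall a b, e a b -> h a = h b) -> forall a b, connect e a b -> h a = h b.
Proof.
move=> h_inv a _ /connectP[p e_p ->].
by elim: p a e_p => //= b p IHp a /andP[/h_inv-> /IHp].
Qed.

Lemma n_compE e : connect_sym e -> n_comp e predT = #|root e @: setT|.
Proof.
move=> e_sym; apply: eq_card => x; rewrite !inE andbT.
apply/eqP/imsetP => [rx|[y _ ->]]; first by exists x.
exact/eqP/roots_root.
Qed.

Lemma leq_invariant_n_comp (rT : finType) e (h : T -> rT) : connect_sym e ->
  (forall a b, e a b -> h a = h b) -> #|h @: setT| <= n_comp e predT.
Proof.
move=> e_sym h_inv; rewrite n_compE // (leq_trans _ (leq_imset_card h _)) //.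
apply/subset_leq_card/subsetP => _ /imsetP[x _ ->].
by rewrite (connect_invariant h_inv (connect_root e x)) !imset_f.
Qed.

Lemma leq_almost_invariant_n_comp (rT : finType) e (h : T -> rT) (X : {set rT}) :
    connect_sym e ->
    (forall a b, e a b -> h a = h b \/ h a \in X /\ h b \in X) ->
  #|h @: setT| <= n_comp e predT + #|X|.-1.
Proof.
move=> e_sym h_inv; have [X0|[x xX]] := set_0Vmem X.
  rewrite X0 cards0 addn0; apply: leq_invariant_n_comp => // a b /h_inv[//|[]].
  by rewrite X0 inE.
pose merge y := if y \in X then x else y.
have merge_inv a b : e a b -> merge (h a) = merge (h b).
  by rewrite /merge => /h_inv[->|[-> ->]].
have -> : #|X|.-1 = #|X :\ x| by rewrite (cardsD1 x) xX.
apply: leq_trans (leq_add (leq_invariant_n_comp e_sym merge_inv) (leqnn _)).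
apply: leq_trans (leq_card_setU _ _).
apply/subset_leq_card/subsetP => _ /imsetP[a _ ->]; rewrite !inE; apply/orP.
have [haX|haX] := boolP (h a \in X); last first.
  by left; apply/imsetP; exists a; rewrite // /merge (negPf haX).
have [hax|] := eqVneq (h a) x; last by right.
by left; apply/imsetP; exists a; rewrite // /merge haX.
Qed.

Lemma n_comp_add_edge e e' u v : connect_sym e -> connect_sym e' ->
    (forall a b, e' a b -> e a b \/ [set a; b] = [set u; v]) ->
  n_comp e predT <= n_comp e' predT + ~~ connect e u v.
Proof.
move=> e_sym e'_sym e'_e; rewrite (n_compE e_sym) -(root_connect e_sym).
pose ends := [set root e u; root e v].
have -> : (root e u != root e v) = #|ends|.-1 :> nat by rewrite cards2.
apply: leq_almost_invariant_n_comp => // a b /e'_e[ab|/eq_set2 ab].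
  by left; apply/eqP; rewrite root_connect // connect1.
by right; case: ab => -[-> ->]; rewrite set21 set22.
Qed.

End Components.

(** * Plane graphs and their duals *)

Section PlaneGraph.
Variable G : plane_graph.
Local Notation V := (vertex G).
Implicit Types (u v w : V) (d : V * V) (W e : {set V}) (S : {set {set V}}).
Implicit Types (f g : face G) (X : {set face G}).

Lemma adjC u v : adj u v -> adj v u.
Proof. by rewrite adj_sym. Qed.

Lemma mem_edges u v : ([set u; v] \in edges G) = adj u v.
Proof.
apply/imsetP/idP => [[[a b]]|uv]; last by exists (u, v); rewrite ?inE.
by rewrite inE /= => ab /eq_set2[[-> ->]|[-> ->]] //; apply: adjC.
Qed.

Lemma edgesP e : reflect (exists u v, adj u v /\ e = [set u; v]) (e \in edges G).
Proof.
apply: (iffP imsetP) => [[[a b]]|[u [v [uv ->]]]].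
  by rewrite inE /= => ab ->; exists a, b.
by exists (u, v); rewrite ?inE.
Qed.

Lemma iter_rot_adj n v u : adj v u -> adj v (iter n (rot v) u).
Proof. by move=> vu; elim: n => //= n; apply: rot_adj. Qed.

Lemma rot_inj v : {in [set u | adj v u] &, injective (rot v)}.
Proof.
apply/imset_injP; rewrite eqn_leq leq_imset_card.
apply/subset_leq_card/subsetP => w; rewrite inE => vw.
have /iter_findex <- := rot_cyclic (rot_adj vw) vw.
by rewrite -iterSr iterS imset_f // inE iter_rot_adj.
Qed.

Definition darts : {set V * V} := [set d | adj d.1 d.2].

Definition rface d := side d.1 d.2.
Definition lface d := rface (swap_pair d).

Lemma rface_swap d : rface (swap_pair d) = lface d.
Proof. by []. Qed.

Lemma lface_swap d : lface (swap_pair d) = rface d.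
Proof. by rewrite /lface swap_pairK. Qed.

Lemma mem_darts d : (d \in darts) = adj d.1 d.2.
Proof. by rewrite inE. Qed.

Lemma eq_edge d d' : [set d.1; d.2] = [set d'.1; d'.2] -> d = d' \/ d = swap_pair d'.
Proof. by case: d d' => [a b] [a' b'] /eq_set2. Qed.

Lemma swap_darts d : (swap_pair d \in darts) = (d \in darts).
Proof. by rewrite !inE adj_sym. Qed.

Definition next_dart d := (d.2, rot d.2 d.1).

Lemma next_dart_in d : d \in darts -> next_dart d \in darts.
Proof. by rewrite !inE /= => /adjC; apply: rot_adj. Qed.

Lemma rface_next_dart d : d \in darts -> rface (next_dart d) = rface d.
Proof. by rewrite inE; apply: side_rot. Qed.

Lemma next_dart_inj : {in darts &, injective next_dart}.
Proof.
move=> [u v] [u' v']; rewrite !inE /= => /adjC vu /adjC vu' [vE].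
rewrite -{v'}vE in vu' * => rot_uu'.
by rewrite (rot_inj _ _ rot_uu') ?inE.
Qed.

Definition leaving W := [set d in darts | (d.1 \in W) && (d.2 \notin W)].

(* The boundary walks of the faces of [X] leave [W] as often as they enter it. *)
Lemma card_leaving W X :
  #|[set d in leaving W | rface d \in X]| = #|[set d in leaving W | lface d \in X]|.
Proof.
pose X_darts := [set d in darts | rface d \in X].
have next_inj : {in X_darts &, injective next_dart}.
  move=> d d'; rewrite inE [d' \in _]inE => /andP[d_dart _] /andP[d'_dart _].
  exact: next_dart_inj.
have next_stable : {in X_darts, forall d, next_dart d \in X_darts}.
  move=> d; rewrite inE [_ \in X_darts]inE => /andP[d_dart dX].
  by rewrite next_dart_in // rface_next_dart.
have := card_stable_preim (fun d => d.1 \in W) next_inj next_stable.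
rewrite /= -(cardsID [set d | d.1 \in W]) -[RHS](cardsID [set d | d.2 \in W]).
have -> : [set d in X_darts | d.2 \in W] :&: [set d | d.1 \in W]
        = [set d in X_darts | d.1 \in W] :&: [set d | d.2 \in W].
  by apply/setP => d; rewrite !inE andbAC.
move/addnI => enter_leave.
have -> : [set d in leaving W | rface d \in X]
        = [set d in X_darts | d.1 \in W] :\: [set d | d.2 \in W].
  by apply/setP => d; rewrite !inE -!andbA; do !bool_congr.
rewrite -enter_leave -(on_card_preimset (onW_bij _ (Bijective swap_pairK swap_pairK))).
by apply: eq_card => d; rewrite !inE /= adj_sym -!andbA; do !bool_congr.
Qed.

Lemma boundary_walk_returns W d : d \in darts -> (d.1 \in W) != (d.2 \in W) ->
  exists d', [/\ d' \in darts, rface d' = rface d, (d'.1 \in W) = (d.2 \in W)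
               & (d'.2 \in W) = (d.1 \in W)].
Proof.
move=> d_dart; wlog d1W : W / d.1 \in W => [wlog_W|].
  case: (boolP (d.1 \in W)) (wlog_W W) (wlog_W (~: W)) => [_ /(_ isT)//|d1W _].
  rewrite !inE d1W; case: (d.2 \in W) => // /(_ isT isT)[d' [? ?]].
  by rewrite !inE => d'1 d'2 _; exists d'; split=> //; apply: negb_inj.
rewrite d1W; case d2W: (d.2 \in W) => // _.
have : 0 < #|[set d' in leaving W | lface d' \in [set rface d]]|.
  rewrite -card_leaving; apply/card_gt0P; exists d.
  by move: d_dart; rewrite !inE d1W d2W eqxx => ->.
case/card_gt0P=> d'; rewrite !inE => /andP[/and3P[d'_dart d'1 d'2] /eqP d'f].
by exists (swap_pair d'); rewrite swap_darts inE (negPf d'2).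
Qed.

Definition incident S : rel V := fun a b => [set a; b] \in S.

Definition dual_adj S : rel (face G) := fun f1 f2 =>
  [exists d in darts, [&& [set d.1; d.2] \in S, rface d == f1 & lface d == f2]].

Lemma incident_connect_sym S : connect_sym (incident S).
Proof. by apply: sym_connect_sym => a b; rewrite /incident setUC. Qed.

Lemma dual_adjP S f1 f2 :
  reflect
    (exists d, [/\ d \in darts, [set d.1; d.2] \in S, rface d = f1 & lface d = f2])
    (dual_adj S f1 f2).
Proof.
apply: (iffP exists_inP) => [[d d_dart /and3P[dS /eqP ? /eqP ?]]|[d [d_dart dS ? ?]]].
  by exists d.
by exists d => //; apply/and3P; split=> //; apply/eqP.
Qed.

Lemma dual_adj_connect_sym S : connect_sym (dual_adj S).
Proof.
apply: sym_connect_sym => f1 f2; apply/dual_adjP/dual_adjP => -[d [d_dart dS <- <-]];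
  by exists (swap_pair d); rewrite swap_darts setUC.
Qed.

Lemma adj_connect_sym : connect_sym (@adj G).
Proof. exact/sym_connect_sym/adj_sym. Qed.

Lemma dual_connect_around u v w : adj u v -> adj u w ->
  connect (dual_adj (edges G)) (side u v) (side u w).
Proof.
move=> uv uw; have /iter_findex <- := rot_cyclic uv uw.
elim: (findex _ _ _) => //= n IHn; apply: connect_trans IHn _.
have /adjC un := iter_rot_adj n uv; rewrite side_rot //.
apply/connect1/dual_adjP; exists (u, iter n (rot u) v).
by rewrite mem_darts /= mem_edges adjC.
Qed.

Lemma dual_connected f1 f2 : connect (dual_adj (edges G)) f1 f2.
Proof.
have dual_root := root_connect (@dual_adj_connect_sym (edges G)).
set r := root _ in dual_root.
have [component [component_face component_vertex]] : exists h : V + face G -> face G,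
    (forall f, h (inr f) = r f) /\
    (forall u v, adj u v -> h (inl u) = r (side u v)).
  pose face_at u := if [pick v | adj u v] is Some v then side u v else outer G.
  exists (fun x => match x with inl u => r (face_at u) | inr f => r f end).
  split=> // u v uv; rewrite /face_at; case: pickP => [w uw|/(_ v)/negP[] //].
  by apply/eqP; rewrite dual_root; apply: dual_connect_around.
rewrite -dual_root -!component_face; apply/eqP.
apply: (connect_invariant (h := component)) (pg_connected (inr f1) (inr f2)).
case=> [u|f] [v|g] //.
- move=> uv; rewrite (component_vertex u v uv) -(side_rot uv).
  by apply/esym/component_vertex/rot_adj/adjC.
- case/existsP=> v /andP[uv /eqP<-]; rewrite component_face.
  exact: component_vertex.
- case/existsP=> w /andP[vw /eqP<-]; rewrite component_face.
  exact/esym/component_vertex.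
Qed.

Lemma n_comp_dual : n_comp (dual_adj (edges G)) predT = 1.
Proof.
rewrite -(n_comp_connect (@dual_adj_connect_sym (edges G)) (outer G)).
by apply: eq_n_comp_r => f; rewrite [RHS]dual_connected.
Qed.

Lemma n_comp_incident_setU1 S u v :
  n_comp (incident S) predT
    <= n_comp (incident ([set u; v] |: S)) predT + ~~ connect (incident S) u v.
Proof.
apply: n_comp_add_edge; try exact: incident_connect_sym.
by move=> a b /setU1P[]; [right|left].
Qed.

Lemma n_comp_dual_adj_setU1 S d :
  n_comp (dual_adj S) predT
    <= n_comp (dual_adj ([set d.1; d.2] |: S)) predT
       + ~~ connect (dual_adj S) (rface d) (lface d).
Proof.
apply: n_comp_add_edge; try exact: dual_adj_connect_sym.
move=> f1 f2 /dual_adjP[d' [d'd /setU1P[/eq_edge d'E|d'S] <- <-]]; last first.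
  by left; apply/dual_adjP; exists d'.
by right; case: d'E => -> //; rewrite setUC lface_swap.
Qed.

(* If adding an edge to [S] joins two components, then it closes no cycle, so
   removing it from the dual of the complement of [S] separates no faces. *)
Lemma dual_connect_faces S d : d \in darts -> ~~ connect (incident S) d.1 d.2 ->
  connect (dual_adj (edges G :\: ([set d.1; d.2] |: S))) (rface d) (lface d).
Proof.
move=> d_dart d_sep; set D := dual_adj _; apply: contraT => faces_sep.
pose W := [set w | connect (incident S) d.1 w].
pose X := [set f | connect D (rface d) f].
have rface_lface d' : d' \in leaving W -> d' != d ->
    (rface d' \in X) = (lface d' \in X).
  rewrite !inE => /and3P[d'_dart d'1 d'2] d'd.
  have d'D : D (rface d') (lface d').
    apply/dual_adjP; exists d'; rewrite mem_darts; split=> //.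
    rewrite !inE mem_edges d'_dart andbT negb_or; apply/andP; split.
      apply: contra d'd => /eqP/eq_edge[->//|d'E].
      by rewrite d'E (negPf d_sep) in d'1.
    by apply: contra d'2 => d'S; apply: connect_trans d'1 (connect1 d'S).
  exact: same_connect_r (@dual_adj_connect_sym _) _ _ (connect1 d'D) _.
have d_leaving : d \in leaving W by move: d_dart; rewrite !inE connect0 d_sep => ->.
pose right_in := [set d' in leaving W | rface d' \in X].
pose left_in := [set d' in leaving W | lface d' \in X].
have d_right_in : d \in right_in by rewrite in_set d_leaving in_set connect0.
have d_left_out : d \notin left_in by rewrite in_set d_leaving in_set.
suff same_D1 : right_in :\ d = left_in :\ d.
  have : #|right_in| = #|left_in| by apply: card_leaving.
  rewrite (cardsD1 d right_in) (cardsD1 d left_in) d_right_in (negPf d_left_out).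
  by rewrite same_D1 => /addIn.
apply/setP => d'; rewrite !in_setD1; have [//|d'd] := eqVneq d' d.
rewrite [d' \in right_in]in_set [d' \in left_in]in_set.
by have [d'W|//] := boolP (d' \in leaving W); rewrite rface_lface.
Qed.

Lemma n_comp_incident_dual_setU1 S u v : adj u v -> [set u; v] \notin S ->
  n_comp (incident S) predT
      + n_comp (dual_adj (edges G :\: ([set u; v] |: S))) predT
    <= n_comp (incident ([set u; v] |: S)) predT
      + n_comp (dual_adj (edges G :\: S)) predT + 1.
Proof.
move=> uv uvS; set uv_S := _ |: S.
have primal : n_comp (incident S) predT
    <= n_comp (incident uv_S) predT + ~~ connect (incident S) u v.
  exact: n_comp_incident_setU1.
have dual : n_comp (dual_adj (edges G :\: uv_S)) predT
    <= n_comp (dual_adj (edges G :\: S)) predT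
       + ~~ connect (dual_adj (edges G :\: uv_S)) (side u v) (side v u).
  have -> : edges G :\: S = [set u; v] |: (edges G :\: uv_S).
    apply/setP => e; rewrite in_setU1 !in_setD in_setU1.
    by have [->|//] := eqVneq e [set u; v]; rewrite uvS mem_edges uv.
  exact: (n_comp_dual_adj_setU1 _ (u, v)).
have joined_once : ~~ connect (incident S) u v ->
    connect (dual_adj (edges G :\: uv_S)) (side u v) (side v u).
  by apply: (@dual_connect_faces S (u, v)); rewrite inE.
case: (connect (incident _) u v) joined_once primal => [_|/(_ isT) uv_dual].
  by case: (connect _ _ _) dual; lia.
by rewrite uv_dual in dual; lia.
Qed.

Lemma euler_inequality S : S \subset edges G ->
  #|V| + n_comp (dual_adj (edges G :\: S)) predT
    <= #|S| + n_comp (incident S) predT + 1.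
Proof.
have [n] := ubnP #|S|; elim: n S => // n IHn S S_lt_n S_edges.
have [->|[e eS]] := set_0Vmem S.
  rewrite cards0 setD0 n_comp_dual leq_add2r -cardsT -[setT]imset_id.
  apply: leq_invariant_n_comp => [|a b]; first exact: incident_connect_sym.
  by rewrite /incident inE.
have /edgesP[u [v [uv eE]]] := subsetP S_edges _ eS.
have card_S : #|S| = #|S :\ e|.+1 by rewrite (cardsD1 e) eS.
have := IHn (S :\ e); rewrite -ltnS -card_S => /(_ S_lt_n).
move/(_ (subset_trans (subD1set _ _) S_edges)).
have := @n_comp_incident_dual_setU1 (S :\ e) u v uv.
by rewrite -eE setD11 setD1K // => /(_ isT); lia.
Qed.

End PlaneGraph.

(** * Bipartite subgraphs of the dual *)

Section DualBipartite.
Variables (G : plane_graph) (D : {set vertex G * vertex G}).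
Local Notation V := (vertex G).
Implicit Types (d : V * V) (W : {set V}).

Definition dual_ends : {set face G} := (@rface G @: D) :|: (@lface G @: D).

Hypothesis D_darts : D \subset darts G.
Hypothesis D_bipartite : [disjoint @rface G @: D & @lface G @: D].
Hypothesis D_simple : {in D &, injective (fun d => (rface d, lface d))}.

Let K : {set {set V}} := [set [set d.1; d.2] | d in D].
Let S := edges G :\: K.

Lemma rface_neq_lface d d' : d \in D -> d' \in D -> rface d != lface d'.
Proof.
move=> dD d'D; apply: contraTneq (imset_f (@rface G) dD) => ->.
by rewrite (disjointFl D_bipartite) // imset_f.
Qed.

Lemma bipartite_edge_inj : {in D &, injective (fun d => [set d.1; d.2])}.
Proof.
move=> d d' dD d'D /eq_edge[//|dE].
by have := rface_neq_lface dD d'D; rewrite dE eqxx.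
Qed.

Lemma n_comp_deletion_ge :
  n_comp (@adj G) predT + #|D| <= n_comp (incident S) predT + #|dual_ends|.-1.
Proof.
have card_K : #|K| = #|D| by rewrite card_in_imset //; apply: bipartite_edge_inj.
have K_edges : K \subset edges G.
  apply/subsetP => _ /imsetP[d /(subsetP D_darts) + ->].
  by rewrite mem_darts mem_edges.
have card_S : #|edges G| = #|S| + #|D|.
  by rewrite -card_K -(cardsID K (edges G)) (setIidPr K_edges) addnC.
have face_bound : #|face G| <= n_comp (dual_adj K) predT + #|dual_ends|.-1.
  rewrite -cardsT -[setT]imset_id; apply: leq_almost_invariant_n_comp.
    exact: dual_adj_connect_sym.
  move=> _ _ /dual_adjP[d [_ /imsetP[d' d'D dE] <- <-]]; right.
  by have [->|->] := eq_edge dE; rewrite !inE ?rface_swap ?lface_swap !imset_f ?orbT.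
have := euler_inequality (subsetDl (edges G) K).
rewrite -/S setDDr setDv set0U (setIidPr K_edges).
have : #|V| + #|face G| = #|edges G| + n_comp (@adj G) predT + 1 by apply: pg_euler.
lia.
Qed.

Definition crossing W := [set d in D | (d.1 \in W) != (d.2 \in W)].

Section Saturated.
Variable W : {set V}.
Hypothesis W_saturated : forall a b, incident S a b -> (a \in W) = (b \in W).

Lemma crossing_edge d : d \in darts G -> (d.1 \in W) != (d.2 \in W) ->
  d \in D \/ swap_pair d \in D.
Proof.
rewrite mem_darts => d_adj d_cross.
have [/imsetP[d' d'D /eq_edge[->|->]]|dK] := boolP ([set d.1; d.2] \in K).
- by left.
- by right; rewrite swap_pairK.
by rewrite (W_saturated (b := d.2)) ?eqxx // /incident inE dK mem_edges in d_cross.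
Qed.

Lemma crossing_rface d : d \in crossing W ->
  exists2 d', d' \in crossing W :\ d & rface d' = rface d.
Proof.
rewrite inE => /andP[dD d_cross].
have [d' [d'_dart d'f d'1 d'2]] := boundary_walk_returns (subsetP D_darts _ dD) d_cross.
have d'_cross : (d'.1 \in W) != (d'.2 \in W) by rewrite d'1 d'2 eq_sym.
exists d' => //; rewrite in_setD1 inE d'_cross andbT; apply/andP; split.
  by apply: contra_neq d_cross => d'd; rewrite -d'1 d'd.
have [//|/(rface_neq_lface dD)] := crossing_edge d'_dart d'_cross.
by rewrite lface_swap d'f eqxx.
Qed.

Lemma crossing_lface d : d \in crossing W ->
  exists2 d', d' \in crossing W :\ d & lface d' = lface d.
Proof.
rewrite inE => /andP[dD d_cross].
have [] := @boundary_walk_returns G W (swap_pair d).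
- by rewrite swap_darts (subsetP D_darts).
- by rewrite eq_sym.
move=> d' [d'_dart d'f d'1 d'2].
have d'_cross : (d'.1 \in W) != (d'.2 \in W) by rewrite d'1 d'2.
exists (swap_pair d'); last by rewrite lface_swap.
rewrite in_setD1 inE [_ == (_ \in W)]eq_sym d'_cross andbT; apply/andP; split.
  by apply: contra_neq d_cross => d'd; move: d'1; rewrite -d'd /= => ->.
have [/(fun d'D => rface_neq_lface d'D dD)|//] := crossing_edge d'_dart d'_cross.
by rewrite d'f eqxx.
Qed.

Lemma crossing_ge4 : crossing W != set0 -> 4 <= #|crossing W|.
Proof.
apply: (simple_bipartite_card_ge4 (p := @rface G) (q := @lface G)).
- by move=> d d'; rewrite !inE => /andP[dD _] /andP[d'D _]; apply: D_simple.
- exact: crossing_rface.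
- exact: crossing_lface.
Qed.

End Saturated.

Let component := root (incident S).
Let crossed := [set x | crossing [set a | component a == x] != set0].

Lemma incident_component a b : incident S a b -> component a = component b.
Proof.
move=> ab; apply/eqP; rewrite root_connect ?connect1 //.
exact: incident_connect_sym.
Qed.

Lemma n_comp_deletion_le :
  n_comp (incident S) predT <= n_comp (@adj G) predT + #|crossed|.-1.
Proof.
rewrite n_compE; last exact: incident_connect_sym.
apply: leq_almost_invariant_n_comp; first exact: adj_connect_sym.
move=> a b ab; have [abK|abK] := boolP ([set a; b] \in K); last first.
  by left; apply: incident_component; rewrite /incident inE abK mem_edges.
have [|ab_sep] := eqVneq (component a) (component b); [by left|right].
have [d dD /esym/(@eq_edge G d (a, b)) d_ab] := imsetP abK.
have d_sep : component d.1 != component d.2.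
  by case: d_ab => -> //=; rewrite eq_sym.
have d_crossed x : x = component d.1 \/ x = component d.2 -> x \in crossed.
  rewrite inE => x_d; apply/set0Pn; exists d; rewrite !inE dD.
  by case: x_d => ->; rewrite eqxx ?[component d.2 == _]eq_sym (negPf d_sep).
by split; apply: d_crossed; case: d_ab => ->; [left|right|right|left].
Qed.

Lemma card_crossed : 2 * #|crossed| <= #|D|.
Proof.
pose cut x := crossing [set a | component a == x].
have cut_ge4 x : x \in crossed -> 4 <= #|cut x|.
  rewrite inE; apply: crossing_ge4 => a b ab.
  by rewrite !inE (incident_component ab).
suff : 4 * #|crossed| <= 2 * #|D| by lia.
apply: (@leq_trans (\sum_(x in crossed) #|cut x|)).
  by rewrite mulnC -sum_nat_const; apply: leq_sum.
pose ends_at x d : nat := (component d.1 == x) + (component d.2 == x).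
apply: (@leq_trans (\sum_x \sum_(d in D) ends_at x d)).
  rewrite big_mkcond; apply: leq_sum => x _; case: ifP => // _.
  rewrite -sum1_card big_mkcond [X in _ <= X]big_mkcond; apply: leq_sum => d _.
  by rewrite !inE /ends_at; case: (d \in D) => //; do 2!case: (_ == x).
rewrite exchange_big mulnC -sum_nat_const; apply: leq_sum => d _.
have sum_eq y : \sum_(x : V) (y == x) = 1.
  by rewrite (bigD1 y) //= eqxx big1 // => x; rewrite eq_sym => /negPf->.
by rewrite /ends_at big_split /= !sum_eq.
Qed.

Lemma dual_bipartite_bound : 1 < #|D| -> #|D| + 4 <= 2 * #|dual_ends|.
Proof.
by have := n_comp_deletion_ge; have := n_comp_deletion_le; have := card_crossed; lia.
Qed.

End DualBipartite.

Lemma dual_complete_bipartite (G : plane_graph) (A B : {set face G}) :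
    [disjoint A & B] ->
    {in A & B, forall f g, exists d, [/\ d \in darts G, rface d = f & lface d = g]} ->
  #|A| <= 2 \/ #|B| <= 2.
Proof.
move=> AB_disjoint AB_adj.
pose joins (p : face G * face G) d := [/\ d \in darts G, rface d = p.1 & lface d = p.2].
have AB_joined : {in setX A B, forall p, exists d, joins p d}.
  by move=> [f g]; rewrite inE => /andP[fA gB]; apply: AB_adj.
have joins_inj p p' d : joins p d -> joins p' d -> p = p'.
  by case: p p' => [f g] [f' g'] [_ /= <- <-] [_ /= <- <-].
have [D [card_D D_joins D_uniq]] := ex_transversal AB_joined joins_inj.
have D_darts : D \subset darts G by apply/subsetP => d /D_joins[p _ []].
have rface_D : @rface G @: D \subset A.
  by apply/subsetP => _ /imsetP[d /D_joins[p + [_ -> _]] ->]; rewrite inE => /andP[].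
have lface_D : @lface G @: D \subset B.
  by apply/subsetP => _ /imsetP[d /D_joins[p + [_ _ ->]] ->]; rewrite inE => /andP[].
have D_bipartite : [disjoint @rface G @: D & @lface G @: D].
  exact: disjointWl rface_D (disjointWr lface_D AB_disjoint).
have D_simple : {in D &, injective (fun d => (rface d, lface d))}.
  move=> d d' dD d'D [rE lE]; apply: (D_uniq (rface d, lface d) d d') => //.
    by split; rewrite ?(subsetP D_darts).
  by split; rewrite ?(subsetP D_darts) /= ?rE ?lE.
have card_ends : #|dual_ends D| <= #|A| + #|B|.
  by rewrite (leq_trans (leq_card_setU _ _)) // leq_add ?subset_leq_card.
have := dual_bipartite_bound D_darts D_bipartite D_simple; rewrite card_D cardsX.
case: (leqP #|A| 2) => [|A_gt2]; first by left.
case: (leqP #|B| 2) => [|B_gt2]; first by right.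
nia.
Qed.

(** * Cells, perfect matchings and flips *)

Section Cells.
Variable G : plane_graph.
Local Notation V := (vertex G).
Implicit Types (u v : V) (C : {set {set V}}) (e : {set V}) (f g : face G).

Lemma cycle_two_edges C v : is_cycle C -> v \in cover C ->
  exists e1 e2, [/\ e1 \in C, e2 \in C, e1 != e2, v \in e1 & v \in e2].
Proof.
case=> s [s_gt2 /andP[_ s_uniq] ->] vC.
have vs : v \in s.
  by case/bigcupP: vC => _ /imsetP[x xs ->] /set2P[]->; rewrite ?mem_next.
exists [set v; next s v], [set prev s v; v]; split; rewrite ?set21 ?set22 //.
- exact: imset_f.
- by apply/imsetP; exists (prev s v); rewrite ?mem_prev ?next_prev.
by apply: contra_neq (next_neq_prev s_uniq s_gt2 vs) => /eq_set2[[<- ->]|[->]].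
Qed.

Lemma mem_boundary f u v :
  ([set u; v] \in boundary f) = adj u v && ((side u v == f) || (side v u == f)).
Proof.
apply/imsetP/andP => [[[a b]]|[uv /orP[uv_f|vu_f]]].
- rewrite inE /= => /andP[ab /eqP<-] /eq_set2[[-> ->]|[-> ->]].
    by rewrite ab eqxx.
  by rewrite adjC // eqxx orbT.
- by exists (u, v); rewrite // inE /= uv.
- by exists (v, u); [rewrite inE /= adjC | apply: setUC].
Qed.

Lemma boundaryP f e :
  reflect (exists u v, [/\ adj u v, side u v = f & e = [set u; v]]) (e \in boundary f).
Proof.
apply: (iffP imsetP) => [[[u v]]|[u [v [uv uv_f ->]]]].
  by rewrite inE /= => /andP[uv /eqP uv_f] ->; exists u, v.
by exists (u, v); rewrite // inE /= uv uv_f eqxx.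
Qed.

Lemma boundary_edges f : boundary f \subset edges G.
Proof. by apply/subsetP => _ /boundaryP[u [v [uv _ ->]]]; rewrite mem_edges. Qed.

Lemma disjoint_boundary f g e : [disjoint cover (boundary f) & cover (boundary g)] ->
  e \in boundary f -> e \notin boundary g.
Proof.
move=> fg_disjoint ef; apply/negP => eg; have /boundaryP[u [v [_ _ eE]]] := ef.
have ue : u \in e by rewrite eE set21.
have uf : u \in cover (boundary f) by apply/bigcupP; exists e.
have : u \in cover (boundary g) by apply/bigcupP; exists e.
by rewrite (disjointFr fg_disjoint uf).
Qed.

Lemma inside_boundary f : f <> outer G -> inside (boundary f) f.
Proof.
move=> f_inner; apply/negP => /connectP[p]; case/lastP: p => [_ /f_inner //|p g].
rewrite rcons_path last_rcons => /andP[_ + fg]; rewrite -fg.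
case/existsP=> u /existsP[v /and4P[uv uv_f _ vu_f]].
by rewrite mem_boundary uv vu_f orbT in uv_f.
Qed.

Lemma cell_dart f : cell f -> exists u v, adj u v /\ side u v = f.
Proof.
case=> _ [[|x s] [// _ _ bE]].
have /boundaryP[u [v [uv uv_f _]]] : [set x; next (x :: s) x] \in boundary f.
  by rewrite bE; apply: imset_f (mem_head x s).
by exists u, v.
Qed.

Lemma cell_rot_neq f u v : cell f -> adj u v -> side u v = f -> rot v u != u.
Proof.
move=> [_ f_cycle] uv uv_f; apply: contraTneq isT => rot_u.
have nbr_v a : adj v a -> a = u.
  by move/(rot_cyclic (adjC uv))/iter_findex <-; apply: iter_fix.
have edge_v e : e \in boundary f -> v \in e -> e = [set v; u].
  case/boundaryP=> a [b [ab _ ->]] /set2P[] va; rewrite -va in ab *.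
    by rewrite (nbr_v b).
  by rewrite (nbr_v a) 1?setUC // adjC.
have vC : v \in cover (boundary f).
  by apply/bigcupP; exists [set u; v]; rewrite ?set22 // mem_boundary uv uv_f eqxx.
have [e1 [e2 [e1f e2f + ve1 ve2]]] := cycle_two_edges f_cycle vC.
by rewrite (edge_v e1) // (edge_v e2) // eqxx.
Qed.

End Cells.

Section PerfectMatchings.
Variable G : plane_graph.
Local Notation V := (vertex G).
Implicit Types (v : V) (M N C : {set {set V}}) (e : {set V}).
Local Notation perfect M := (perfect_matching setT (edges G) M).

Lemma in_symdiff M N e : (e \in symdiff M N) = (e \in M) (+) (e \in N).
Proof. by rewrite !inE; case: (e \in M); case: (e \in N). Qed.

Lemma symdiffC M N : symdiff M N = symdiff N M.
Proof. exact: setUC. Qed.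

Lemma symdiffK N : cancel (fun M => symdiff M N) (fun M => symdiff M N).
Proof. by move=> M; apply/setP => e; rewrite !in_symdiff -addbA addbb addbF. Qed.

Lemma perfect_sub M : perfect M -> M \subset edges G.
Proof. by case/andP. Qed.

Lemma perfect_exists M v : perfect M -> exists2 e, e \in M & v \in e.
Proof.
case/andP=> _ /and3P[/eqP cover_M _ _]; have: v \in cover M by rewrite cover_M.
by case/bigcupP=> e; exists e.
Qed.

Lemma perfect_unique M v e1 e2 : perfect M ->
  e1 \in M -> e2 \in M -> v \in e1 -> v \in e2 -> e1 = e2.
Proof.
case/andP=> _ /and3P[_ /trivIsetP M_disjoint _] e1M e2M ve1; apply: contraTeq.
by move/(M_disjoint _ _ e1M e2M)/disjointFr => ->.
Qed.

Lemma perfect_local M : M \subset edges G ->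
  (forall v, exists2 N, perfect N & forall e, v \in e -> (e \in M) = (e \in N)) ->
  perfect M.
Proof.
move=> M_edges M_local; rewrite /perfect_matching M_edges /=; apply/and3P; split.
- apply/eqP/setP => v; rewrite inE; have [N pN MN] := M_local v.
  have [e eN ve] := perfect_exists v pN.
  by apply/bigcupP; exists e; rewrite ?MN.
- apply/trivIsetP => e1 e2 e1M e2M; apply: contraNT => /pred0Pn[v /andP[/= ve1 ve2]].
  have [N pN MN] := M_local v; rewrite !MN // in e1M e2M.
  by rewrite (perfect_unique pN e1M e2M ve1).
- by apply/negP => /(subsetP M_edges)/edgesP[u [v [_ /setP/(_ u)]]]; rewrite !inE eqxx.
Qed.

Lemma alternating_edges_at M C v : alternating M C -> v \in cover C ->
  (exists e, [/\ e \in C, v \in e & e \in M]) /\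
  (exists e, [/\ e \in C, v \in e & e \notin M]).
Proof.
case=> C_cycle M_alt /(cycle_two_edges C_cycle)[e1 [e2 [e1C e2C e12 ve1 ve2]]].
have : (e1 \in M) != (e2 \in M).
  by apply: M_alt => //; apply/pred0Pn; exists v; rewrite /= ve1.
case e1M : (e1 \in M); case e2M : (e2 \in M) => // _; split.
- by exists e1.
- by exists e2; rewrite e2M.
- by exists e2.
- by exists e1; rewrite e1M.
Qed.

End PerfectMatchings.

Section Flips.
Variables (G : plane_graph) (c : vertex G -> bool).
Local Notation V := (vertex G).
Implicit Types (u v : V) (M N P : {set {set V}}) (f g : face G).
Local Notation perfect M := (perfect_matching setT (edges G) M).

Definition flip f M N := [/\ cell f, symdiff M N = boundary f
  & proper_alternating c M (boundary f)].

Lemma flip_source_inj f M N P : flip f M P -> flip f N P -> M = N.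
Proof. by move=> [_ MP _] [_ NP _]; apply: (can_inj (symdiffK P)); rewrite MP NP. Qed.

Lemma flip_target_inj f M N P : flip f M N -> flip f M P -> N = P.
Proof.
move=> [_ MN _] [_ MP _]; apply: (can_inj (symdiffK M)).
by rewrite symdiffC MN -MP symdiffC.
Qed.

(* Flipping [g] first leads from [M] to [P] through [Q] instead of [N]. *)
Section SwapFlips.
Variables (f g : face G) (M N P : {set {set V}}).
Hypotheses (M_flip : flip f M N) (N_flip : flip g N P).
Hypothesis fg_disjoint : [disjoint cover (boundary f) & cover (boundary g)].

Let Q := symdiff P (boundary f).

Lemma swapped_matching_source : Q = symdiff M (boundary g).
Proof.
have [[_ MN _] [_ NP _]] := (M_flip, N_flip).
apply/setP => e; rewrite -NP /Q -MN !in_symdiff.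
by case: (e \in M); case: (e \in N); case: (e \in P).
Qed.

Lemma swapped_matching_perfect : perfect M -> perfect P -> perfect Q.
Proof.
move=> pM pP; apply: perfect_local => [|v].
  apply/subsetP => e; rewrite in_symdiff; have [eP|_] := boolP (e \in P).
    by rewrite (subsetP (perfect_sub pP)).
  exact: (subsetP (boundary_edges f)).
have [vf|vf] := boolP (v \in cover (boundary f)); [exists M | exists P] => // e ve.
  rewrite swapped_matching_source in_symdiff.
  have [eg|_] := boolP (e \in boundary g); last by rewrite addbF.
  have vg : v \in cover (boundary g) by apply/bigcupP; exists e.
  by rewrite (disjointFr fg_disjoint vf) in vg.
rewrite in_symdiff; have [ef|_] := boolP (e \in boundary f); last by rewrite addbF.
by case/bigcupP: vf; exists e.
Qed.

Lemma swapped_flip : flip f Q P.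
Proof.
have [f_cell _ [[f_cycle M_alt] M_white]] := M_flip.
have Q_M e : e \in boundary f -> (e \in Q) = (e \in M).
  move=> /(disjoint_boundary fg_disjoint) eg.
  by rewrite swapped_matching_source in_symdiff (negPf eg) addbF.
split=> //; first by apply/setP => e; rewrite !in_symdiff addbC addKb.
split; first by split=> // e1 e2 e1f e2f; rewrite !Q_M //; apply: M_alt.
by move=> u v uv uv_f; rewrite Q_M //; apply: M_white.
Qed.

End SwapFlips.

Hypothesis c_proper : proper_coloring c.

Lemma flip_source f M N u v : flip f M N -> adj u v -> side u v = f ->
  ([set u; v] \in M) = c u.
Proof.
move=> [[f_inner f_cycle] _ [[_ M_alt] M_white]] uv uv_f.
have f_inside := inside_boundary f_inner.
have uv_boundary : [set u; v] \in boundary f by rewrite mem_boundary uv uv_f eqxx.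
have [uvM|uvM] := boolP ([set u; v] \in M).
  by case: (M_white u v) => //; rewrite uv_f.
pose w := rot v u.
have vw : adj v w by apply/rot_adj/adjC.
have vw_f : side v w = f by rewrite side_rot.
have vw_boundary : [set v; w] \in boundary f by rewrite mem_boundary vw vw_f eqxx.
have uv_neq_vw : [set u; v] != [set v; w].
  apply/eqP => /eq_set2[[uE _]|[uE]]; first by rewrite uE adj_irr in uv.
  by have := cell_rot_neq (conj f_inner f_cycle) uv uv_f; rewrite -/w -uE eqxx.
have uv_meets_vw : ~~ [disjoint [set u; v] & [set v; w]].
  by apply/pred0Pn; exists v; rewrite /= set21 set22.
have : [set v; w] \in M.
  have := M_alt _ _ uv_boundary vw_boundary uv_neq_vw uv_meets_vw.
  by rewrite (negPf uvM); case: (_ \in M).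
case/(M_white v w vw vw_boundary) => [|cv _]; first by rewrite vw_f.
by have := c_proper uv; rewrite cv; case: (c u).
Qed.

Lemma flip_target f M N u v : flip f M N -> adj u v -> side u v = f ->
  ([set u; v] \in N) = ~~ c u.
Proof.
move=> M_flip uv uv_f; rewrite -(flip_source M_flip uv uv_f).
case: M_flip => _ /setP/(_ [set u; v]) + _.
by rewrite in_symdiff mem_boundary uv uv_f eqxx; case: (_ \in M); case: (_ \in N).
Qed.

Lemma flip_irrefl f M : ~ flip f M M.
Proof.
move=> M_flip; have [f_cell _ _] := M_flip; have [u [v [uv uv_f]]] := cell_dart f_cell.
have := flip_target M_flip uv uv_f; rewrite (flip_source M_flip uv uv_f).
by case: (c u).
Qed.

Lemma flip_other_side f M N u v : flip f M N -> adj u v -> side u v = f ->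
  side v u != f.
Proof.
move=> M_flip uv uv_f; apply: contraTneq (c_proper uv) => vu_f.
by rewrite -(flip_source M_flip uv) // -(flip_source M_flip (adjC uv)) // setUC eqxx.
Qed.

Lemma consecutive_flips_neq f g M N P : flip f M N -> flip g N P -> f != g.
Proof.
move=> M_flip N_flip; have [f_cell _ _] := M_flip.
have [u [v [uv uv_f]]] := cell_dart f_cell.
apply/eqP => fg; have := flip_target M_flip uv uv_f.
by rewrite (flip_source N_flip uv) -?fg //; case: (c u).
Qed.

(* At a common vertex, the edges of both boundaries that lie in [N] coincide. *)
Lemma consecutive_flips_adjacent f g M N P :
    perfect N -> flip f M N -> flip g N P ->
    ~~ [disjoint cover (boundary f) & cover (boundary g)] ->
  exists d, [/\ d \in darts G, rface d = f & lface d = g].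
Proof.
move=> pN M_flip N_flip /pred0Pn[v /andP[/= vf vg]].
have [[_ MN [M_alt _]] [_ _ [N_alt _]]] := (M_flip, N_flip).
have [_ [e [ef ve eM]]] := alternating_edges_at M_alt vf.
have [[e' [e'g ve' e'N]] _] := alternating_edges_at N_alt vg.
have eN : e \in N by have := ef; rewrite -MN in_symdiff (negPf eM).
have /boundaryP[a [b [ab ab_f eE]]] := ef.
exists (a, b); split; rewrite ?mem_darts //; apply/eqP.
move: e'g; rewrite -(perfect_unique pN eN e'N ve ve') eE mem_boundary ab ab_f.
by rewrite (negPf (consecutive_flips_neq M_flip N_flip)).
Qed.

(* [n f] counts how often the face [f] is flipped on the way from [M] to [N]. *)
Definition flip_counts M N (n : face G -> nat) := n (outer G) = 0 /\
  forall u v, adj u v -> c u ->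
    ([set u; v] \in M) + n (side v u) = ([set u; v] \in N) + n (side u v).

Lemma flip_counts_refl M : flip_counts M M (fun=> 0).
Proof. by []. Qed.

Lemma flip_counts_flip f M N : flip f M N -> flip_counts M N (fun g => g == f).
Proof.
move=> M_flip; have [[f_inner _] MN _] := M_flip; split=> [|u v uv cu].
  by case: eqP => // /esym.
have vu := adjC uv; have := c_proper uv; rewrite cu => cv.
have [uv_f|uv_f] := eqVneq (side u v) f.
  rewrite (negPf (flip_other_side M_flip uv uv_f)).
  by rewrite (flip_source M_flip uv uv_f) (flip_target M_flip uv uv_f) cu.
have [vu_f|vu_f] := eqVneq (side v u) f.
  rewrite setUC (flip_source M_flip vu vu_f) (flip_target M_flip vu vu_f).
  by case: (c v) cv.
have : [set u; v] \notin symdiff M N.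
  by rewrite MN mem_boundary negb_and negb_or uv_f vu_f orbT.
by rewrite in_symdiff; case: (_ \in M); case: (_ \in N).
Qed.

Lemma flip_counts_trans M N P n m :
  flip_counts M N n -> flip_counts N P m -> flip_counts M P (fun f => n f + m f).
Proof.
move=> [n0 nE] [m0 mE]; split=> [|u v uv cu]; first by rewrite n0 m0.
by have := nE u v uv cu; have := mE u v uv cu; lia.
Qed.

Lemma flip_counts_unique M N n m : flip_counts M N n -> flip_counts M N m -> n =1 m.
Proof.
move=> [n0 nE] [m0 mE] f.
have white_side u v : adj u v -> c u ->
    (n (side u v) == m (side u v)) = (n (side v u) == m (side v u)).
  by move=> uv cu; have := nE u v uv cu; have := mE u v uv cu; lia.
have dual_step f1 f2 : dual_adj (edges G) f1 f2 -> (n f1 == m f1) = (n f2 == m f2).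
  case/dual_adjP=> -[u v] []; rewrite mem_darts /lface /rface /= => uv _ <- <-.
  case cu : (c u); first exact: white_side.
  apply/esym/white_side; first exact: adjC.
  by have := c_proper uv; rewrite cu; case: (c v).
have := connect_invariant (h := fun f => n f == m f) dual_step
  (dual_connected (outer G) f).
by rewrite n0 m0 => /esym/eqP.
Qed.

Lemma Zle_first_arc (M N : matching G) : Zle c N M ->
  M = N \/ exists2 P, Zarc c M P & Zle c N P.
Proof.
case/clos_rt_rt1n_iff => [|P N' arc path]; first by left.
by right; exists P => //; apply/clos_rt_rt1n_iff.
Qed.

Lemma Zle_flip_counts (M N : matching G) : Zle c N M ->
  exists n, flip_counts (val M) (val N) n.
Proof.
elim=> {M N} [M N [f M_flip]|M|M N P _ [n nE] _ [m mE]].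
- by exists (fun g => g == f); apply: flip_counts_flip M_flip.
- by exists (fun=> 0); apply: flip_counts_refl.
- by exists (fun f => n f + m f); apply: flip_counts_trans nE mE.
Qed.

End Flips.

(** * The covering relation *)

Section Covers.
Variables (disp : Order.disp_t) (L : finDistrLatticeType disp).
Implicit Types x y z : L.

Lemma covered_by_exists x z : (x < z)%O -> exists2 y, covered_by x y & (y <= z)%O.
Proof.
move=> xz; pose P y := (x < y)%O && (y <= z)%O.
have Pz : P z by rewrite /P xz lexx.
case: (arg_minnP (fun y => #|[set t : L | (t <= y)%O]|) Pz) => y /andP[xy yz] y_min.
exists y => //; rewrite /covered_by xy; apply/forallP => t; apply/negP => /andP[xt ty].
have := y_min t; rewrite /P xt (le_trans (ltW ty) yz) => /(_ isT); apply/negP.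
rewrite -ltnNge; apply/proper_card/properP; split.
  by apply/subsetP => s; rewrite !inE => st; apply: le_trans st (ltW ty).
by exists y; rewrite !inE ?lexx // lt_geF.
Qed.

Lemma meet_irreducible_lt x y z :
  meet_irreducible y -> covered_by y x -> (y < z)%O -> (x <= z)%O.
Proof.
case/cards1P=> x' /setP y_cover yx /covered_by_exists[w yw wz].
by have := (y_cover x, y_cover w); rewrite !inE yx yw => -[/esym/eqP-> /esym/eqP<-].
Qed.

Variables (G : plane_graph) (c : vertex G -> bool) (phi : L -> matching G).
Hypotheses (c_proper : proper_coloring c) (phi_bij : bijective phi).
Hypothesis phi_le : forall x y, (x <= y)%O <-> Zle c (phi x) (phi y).

Lemma flip_le x y f : flip c f (val (phi y)) (val (phi x)) -> (x <= y)%O.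
Proof. by move=> y_flip; apply/phi_le/rt_step; exists f. Qed.

Lemma covered_by_Zarc x y : covered_by x y -> Zarc c (phi y) (phi x).
Proof.
case/andP=> xy /forallP no_between; have [psi phiK psiK] := phi_bij.
have /phi_le/Zle_first_arc[/(bij_inj phi_bij) yx|[P arc Px]] := ltW xy.
  by rewrite yx ltxx in xy.
have xP : (x <= psi P)%O by apply/phi_le; rewrite psiK.
have Py : (psi P < y)%O.
  have [f y_flip] := arc; rewrite lt_neqAle (@flip_le _ _ f) ?psiK // andbT.
  by apply/eqP => Py; rewrite -Py psiK in y_flip; apply: (flip_irrefl c_proper y_flip).
have := no_between (psi P); rewrite Py andbT lt_neqAle xP andbT negbK => /eqP xE.
by rewrite xE psiK.
Qed.

Lemma phi_val_inj : injective (val \o phi).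
Proof. exact: inj_comp val_inj (bij_inj phi_bij). Qed.

Lemma flips_from_upper_covers x (U : {set L}) : {in U, forall z, covered_by x z} ->
  exists2 A : {set face G}, #|A| = #|U|
    & {in A, forall f, exists2 z, z \in U & flip c f (val (phi z)) (val (phi x))}.
Proof.
move=> U_covers; pose flip_in z f := flip c f (val (phi z)) (val (phi x)).
have [z zU|z z' f z_flip z'_flip|A [card_A A_flip _]] := @ex_transversal _ _ U flip_in.
- exact: covered_by_Zarc (U_covers z zU).
- exact/phi_val_inj/(flip_source_inj z_flip z'_flip).
by exists A.
Qed.

Lemma flips_to_lower_covers x (D : {set L}) : {in D, forall y, covered_by y x} ->
  exists2 B : {set face G}, #|B| = #|D|
    & {in B, forall g, exists2 y, y \in D & flip c g (val (phi x)) (val (phi y))}.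
Proof.
move=> D_covered; pose flip_out y g := flip c g (val (phi x)) (val (phi y)).
have [y yD|y y' g y_flip y'_flip|B [card_B B_flip _]] := @ex_transversal _ _ D flip_out.
- exact: covered_by_Zarc (D_covered y yD).
- exact/phi_val_inj/(flip_target_inj y_flip y'_flip).
by exists B.
Qed.

(* If the boundaries were disjoint, [f] could be flipped from some [Q] into
   [phi y]; then [x <= Q], yet [g] is flipped on the way from [x] to [y] and not on
   the way from [Q] to [y]. *)
Lemma meet_irreducible_flips_meet x y z f g :
    covered_by y x -> meet_irreducible y ->
    flip c f (val (phi z)) (val (phi x)) -> flip c g (val (phi x)) (val (phi y)) ->
  ~~ [disjoint cover (boundary f) & cover (boundary g)].
Proof.
move=> yx y_irr z_flip x_flip; apply/negP => fg_disjoint.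
have [psi phiK psiK] := phi_bij.
have Q_perfect := swapped_matching_perfect z_flip x_flip fg_disjoint
  (valP (phi z)) (valP (phi y)).
pose Q : matching G := Sub _ Q_perfect.
have Q_flip : flip c f (val Q) (val (phi y)).
  exact: swapped_flip z_flip x_flip fg_disjoint.
have yQ : (y < psi Q)%O.
  rewrite lt_neqAle (@flip_le _ _ f) ?psiK // andbT; apply/eqP => yQ.
  by rewrite yQ psiK in Q_flip; apply: (flip_irrefl c_proper Q_flip).
have /phi_le := meet_irreducible_lt y_irr yx yQ; rewrite psiK.
case/Zle_flip_counts => // n x_counts.
have Q_counts := flip_counts_trans x_counts (flip_counts_flip c_proper x_flip).
have := flip_counts_unique c_proper Q_counts (flip_counts_flip c_proper Q_flip) g.
by rewrite eqxx eq_sym (negPf (consecutive_flips_neq c_proper z_flip x_flip)); lia.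
Qed.

End Covers.

Theorem theorem4p2 (disp : Order.disp_t) (L : finDistrLatticeType disp) (x : L)
    (h_up : 3 <= #|[set y : L | covered_by x y]|)
    (h_down : 3 <= #|[set y : L | covered_by y x && meet_irreducible y]|) :
  ~ matchable L.
Proof.
case=> G [c [c_proper _ _ [phi [phi_bij phi_le]]]].
have [|A card_A A_flip] := flips_from_upper_covers c_proper phi_bij phi_le
    (x := x) (U := [set z | covered_by x z]).
  by move=> z; rewrite inE.
have [|B card_B B_flip] := flips_to_lower_covers c_proper phi_bij phi_le
    (x := x) (D := [set y | covered_by y x && meet_irreducible y]).
  by move=> y; rewrite inE => /andP[].
have AB_disjoint : [disjoint A & B].
  apply/pred0P => f; apply/negP => /andP[/= /A_flip[z _ z_flip] /B_flip[y _ y_flip]].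
  by have := consecutive_flips_neq c_proper z_flip y_flip; rewrite eqxx.
have [f g /A_flip[z _ z_flip] /B_flip[y + y_flip]| |] :=
    dual_complete_bipartite AB_disjoint.
- rewrite inE => /andP[yx y_irr].
  apply: (consecutive_flips_adjacent c_proper (valP (phi x)) z_flip y_flip).
  exact: (meet_irreducible_flips_meet c_proper phi_bij phi_le yx y_irr z_flip y_flip).
- by rewrite card_A leqNgt h_up.
- by rewrite card_B leqNgt h_down.
Qed.
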